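(* Let $r,n$ be positive integers and $0\le k<n$. Then $C_k$ is a system of coset representatives for the subgroup $G(r,k)$ of $G(r,n)$ (every coset $g\,G(r,k)$ with $g\in G(r,n)$ contains exactly one element of $C_k$), and $$\sum_{g\in C_k}q^{\operatorname{fmaj}(g^{-1})}=[r(k+1)]_q\,[r(k+2)]_q\cdots[rn]_q.$$
   Context: For a nonnegative integer $m$, $[m]_q=1+q+\cdots+q^{m-1}$. $\mathbb N$ includes $0$; $\mathcal P_n=\{(\lambda_1,\dots,\lambda_n)\in\mathbb N^n:\lambda_1\ge\cdots\ge\lambda_n\}$. The wreath product $G(r,n)=\mathbb Z_r\wr S_n$ is the group (under composition of maps) of permutations $g$ of the set of $r$-colored integers $i^z$ ($i\in\{1,\dots,n\}$, $z\in\mathbb Z_r=\mathbb Z/r\mathbb Z$) such that $g(i^0)=j^z$ implies $g(i^{z'})=j^{z+z'}$; write $g=[\sigma_1^{z_1},\dots,\sigma_n^{z_n}]$ when $g(i^0)=\sigma_i^{z_i}$; integers are identified with their residues mod $r$ when used as colors. For $k<n$, $G(r,k)$ is identified with the subgroup of $G(r,n)$ of elements of the form $[\sigma_1^{z_1},\dots,\sigma_k^{z_k},(k+1)^0,\dots,n^0]$. For $g=[\sigma_1^{z_1},\dots,\sigma_n^{z_n}]\in G(r,n)$ define: $\operatorname{HDes}(g)=\{i\in\{1,\dots,n-1\}: z_i=z_{i+1},\ \sigma_i>\sigma_{i+1}\}$; $h_i(g)=|\{j\ge i: j\in\operatorname{HDes}(g)\}|$; $(k_1(g),\dots,k_n(g))$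 is the entrywise smallest element of $\mathcal P_n$ such that $g=[\sigma_1^{k_1(g)},\dots,\sigma_n^{k_n(g)}]$; $\lambda_i(g)=r\,h_i(g)+k_i(g)$; and the flag-major index $\operatorname{fmaj}(g)=\sum_{i=1}^n\lambda_i(g)$. $C_k=\{[\sigma_1^0,\dots,\sigma_k^0,\sigma_{k+1}^{z_{k+1}},\dots,\sigma_n^{z_n}]\in G(r,n):\ \sigma_1<\cdots<\sigma_k\}$ (no condition if $k=0$). *)

(* Defs.v *)
From mathcomp Require Import all_boot all_order all_fingroup all_algebra.

Set Implicit Arguments.
Unset Strict Implicit.
Unset Printing Implicit Defensive.

Import GroupScope.

(* The colors Z/rZ, for r > 0.  ['Z_r] is not used because ['Z_1] is Z/2Z;   *)
(* here [color 1] is a singleton and [color r] is ['I_r] for all r > 0.      *)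
Definition color (r : nat) := 'I_r.-1.+1.

Definition color_of (r m : nat) : color r := inZp m.

Section ColoredPermutations.

Variables r n : nat.

(* [(i, z)] stands for the colored integer (i+1)^z: positions and values are *)
(* numbered from 0.                                                          *)
Definition cint := ('I_n * color r)%type.

Implicit Types (g : {perm cint}) (i j : 'I_n) (k : nat) (l : n.-tuple nat).

Definition col0 i : cint := (i, 0%R).

(* If [g (col0 i) = (j, z)], then j is sigma_i and z is z_i.                 *)
Definition sigma g i : 'I_n := (g (col0 i)).1.
Definition zcol g i : color r := (g (col0 i)).2.

(* The group law on {perm _} is [(h * g) x = g (h x)], i.e. the composition  *)
(* of maps g o h is written [h * g].                                         *)
Definition wreath : {set {perm cint}} :=
  [set g : {perm cint} | [forall i : 'I_n, forall z : color r,
     g (i, z) == (sigma g i, (zcol g i + z)%R)]].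

Lemma wreathP g :
  reflect (forall i (z : color r), g (i, z) = (sigma g i, (zcol g i + z)%R))
          (g \in wreath).
Proof.
rewrite inE; apply: (iffP forallP) => [gP i z | gP i].
  by apply/eqP; have /forallP := gP i; apply.
by apply/forallP=> z; apply/eqP.
Qed.

Lemma wreath_group_set : group_set wreath.
Proof.
apply/group_setP; split=> [|g h /wreathP gP /wreathP hP].
  by apply/wreathP=> i z; rewrite /sigma /zcol !perm1 /= GRing.add0r.
apply/wreathP=> i z; rewrite /sigma /zcol !permM !gP GRing.addr0.
by rewrite [in LHS]hP [in RHS]hP /= GRing.addrA.
Qed.
Canonical wreath_group := Group wreath_group_set.

(* The copy of G(r, k) inside G(r, n).                                       *)
Definition wreath_sub k : {set {perm cint}} :=
  [set g : {perm cint} in wreath |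
     [forall i : 'I_n, (k <= i) ==> (g (col0 i) == col0 i)]].

Lemma wreath_sub_group_set k : group_set (wreath_sub k).
Proof.
apply/group_setP; split=> [|g h].
  rewrite inE group1; apply/forallP=> i; apply/implyP=> _.
  by rewrite perm1.
rewrite !inE -!/wreath => /andP[gG /forallP gk] /andP[hG /forallP hk].
rewrite -/(_ \in wreath); apply/andP; split.
  by have := groupM (G := wreath_group) (x := g) (y := h); rewrite !inE; apply.
apply/forallP=> i; apply/implyP=> ki.
by rewrite permM (eqP (implyP (gk i) ki)); exact: (implyP (hk i) ki).
Qed.
Canonical wreath_sub_group k := Group (wreath_sub_group_set k).

Definition coset_reps k : {set {perm cint}} :=
  [set g : {perm cint} in wreath |
     [forall i : 'I_n, (i < k) ==> (zcol g i == 0%R)] &&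
     [forall i : 'I_n, forall j : 'I_n,
        (i < j < k) ==> (sigma g i < sigma g j)]].

Definition HDes g : {set 'I_n} :=
  [set i : 'I_n | [exists j : 'I_n, [&& j == i.+1 :> nat, zcol g i == zcol g j
                        & sigma g j < sigma g i]]].

Definition hdes g i : nat := #|[set j : 'I_n in HDes g | i <= j]|.

(* [l] is in P_n and g = [sigma_1^(l_1), ..., sigma_n^(l_n)].                *)
Definition color_partition g l : Prop :=
  sorted geq l /\ forall i, g (col0 i) = (sigma g i, color_of r (tnth l i)).

Definition least_color_partition g l : Prop :=
  color_partition g l /\
  forall l', color_partition g l' -> forall i, tnth l i <= tnth l' i.

Lemma least_color_partition_unique g l1 l2 :
  least_color_partition g l1 -> least_color_partition g l2 -> l1 = l2.
Proof.
move=> [l1P l1m] [l2P l2m]; apply: eq_from_tnth => i.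
by apply/eqP; rewrite eqn_leq l1m ?l2m.
Qed.

(* [lift_colors s] is the least nonincreasing lift of [s] to natural numbers; *)
(* it only serves to prove that a least color partition exists.              *)
Fixpoint lift_colors (s : seq (color r)) : seq nat :=
  if s is z :: s' then
    let l := lift_colors s' in
    let m := head 0 l in
    (m + (z + (r.-1.+1 - m %% r.-1.+1)) %% r.-1.+1) :: l
  else [::].

Lemma lift_colorsP (s : seq (color r)) :
  [/\ map (color_of r) (lift_colors s) = s, sorted geq (lift_colors s)
    & forall l : seq nat, map (color_of r) l = s -> sorted geq l ->
        forall i : nat, nth 0 (lift_colors s) i <= nth 0 l i].
Proof.
elim: s => [|z s [IHc IHs IHm]]; first by split=> // l _ _ i; rewrite nth_nil.
rewrite /=; set l0 := lift_colors s in IHc IHs IHm *.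
set m := head 0 l0; set p := r.-1.+1.
have lt_mp : m %% p < p by rewrite ltn_mod.
have modE : (m + (z + (p - m %% p)) %% p) %% p = z.
  by rewrite modnDmr -modnDml addnCA subnKC ?(ltnW lt_mp) //
     modnDr modn_small ?ltn_ord.
split.
- by rewrite IHc; congr (_ :: _); apply: val_inj; rewrite /= modE.
- by rewrite /m; case: (l0) IHs => //= a l ->; rewrite andbT leq_addr.
case=> [|a l] //= [za ls] srt [|i] /=; last exact: (IHm l ls (path_sorted srt) i).
have le_ma : m <= a.
  have := IHm l ls (path_sorted srt) 0; rewrite nth0 -/m.
  move/leq_trans; apply; case: (l) srt => //= b l' /andP[//].
rewrite -[leqRHS](subnKC le_ma) leq_add2l.
suff -> : (z + (p - m %% p)) %% p = (a - m) %% p by exact: leq_mod.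
apply/eqP; rewrite -(eqn_modDl m) -[X in X == _]modnDmr subnKC //.
have -> : z = a %% p :> nat by rewrite -za.
by have := modE; rewrite -za /= -/p => ->.
Qed.

Lemma least_color_partition_exists g : {l | least_color_partition g l}.
Proof.
pose s := [seq zcol g i | i <- enum 'I_n].
have [ls_s srt_s min_s] := lift_colorsP s.
have sz_s : size (lift_colors s) == n.
  by rewrite -(size_map (color_of r)) ls_s size_map size_enum_ord.
have colE (l : n.-tuple nat) :
    map (color_of r) l = s <->
    forall i, g (col0 i) = (sigma g i, color_of r (tnth l i)).
  split=> [ls i | lP].
    rewrite [LHS]surjective_pairing -/(sigma g i) -/(zcol g i).
    congr (_, _); have /(congr1 (fun t => nth (zcol g i) t i)) := ls.
    rewrite (nth_map i) ?size_enum_ord // nth_ord_enum => <-.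
    by rewrite (nth_map 0) ?size_tuple // (tnth_nth 0).
  rewrite -(map_tnth_enum l) -map_comp.
  by apply: eq_map => i /=; rewrite /zcol lP.
exists (Tuple sz_s); split=> [|l' [srt' /colE ls'] i].
  by split=> //; apply/colE.
by rewrite !(tnth_nth 0); apply: min_s.
Qed.

(* (k_1(g), ..., k_n(g))                                                     *)
Definition kpart g : n.-tuple nat := sval (least_color_partition_exists g).

Lemma kpartP g : least_color_partition g (kpart g).
Proof. exact: svalP. Qed.

Definition flambda g i : nat := (r * hdes g i + tnth (kpart g) i)%N.

Definition fmaj g : nat := \sum_(i < n) flambda g i.

End ColoredPermutations.

Arguments wreath r n : clear implicits.
Arguments wreath_sub r n k : clear implicits.
Arguments coset_reps r n k : clear implicits.
Arguments wreath_group r n : clear implicits.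
Arguments wreath_sub_group r n k : clear implicits.

(* The q-integer [m]_q, as a polynomial in the indeterminate q = 'X.         *)
Definition qint (m : nat) : {poly int} := (\sum_(i < m) 'X^i)%R.

(* Main.v *)
Require Import Defs.
From mathcomp Require Import all_boot all_order all_fingroup all_algebra.
From mathcomp Require Import zify ring.

Set Implicit Arguments.
Unset Strict Implicit.
Unset Printing Implicit Defensive.

Import GRing.Theory.

(** Why the theorem holds.

    Write an element of G(r, n) as the word of its colored images.  The numbers
    lambda_i of the flag-major index can be read from right to left along the
    word: lambda_i is the least natural number that has the color of the i-th
    letter, is at least lambda_(i+1), and is larger than lambda_(i+1) if the
    i-th letter exceeds the next one.  The condition on colors in the definition
    of a homogeneous descent then takes care of itself: if the two colors
    differ, so do lambda_i and lambda_(i+1) in any case.  This is [lam_hdescs],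
    and [fmajE] restates the index in these terms.

    Now insert a new largest letter N, in each of the r colors, at each of the
    n + 1 places of a word of length n.  If the number of N is m, it is inserted
    before a letter of number b exactly when m ranges over b + 1, ..., b + r as
    the color of N varies (over 0, ..., r - 1 at the end of the word).  Let a be
    the number of the letter that precedes N.  If m <= a, nothing else changes
    and the index grows by m; otherwise the preceding letters all gain r and, if
    there are p of them, the index grows by m + r p.  The increments of the first
    kind, together with those of the first place, fill the interval from 0 to
    lambda_1 + r; the others fill the rest, up to r (n + 1) - 1.  So insertion
    multiplies the generating function of the index by [r(n+1)]_q, which is
    [sum_insertions].

    The word of g^-1, for g in C_k, has the letters 1, ..., k in increasing order
    with color 0 and is otherwise arbitrary.  Such words are obtained, each
    once, from 1^0 ... k^0 (of index 0) by inserting the letters k + 1, ..., n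
    in turn.  Iterating the insertion formula proves the identity.

    As for representatives: right multiplication by G(r, k), in the sense of
    composition of maps, rearranges the first k letters of a word and changes
    their colors at will, and the elements of C_k are those whose first k letters
    are sorted and have color 0.  So the representative of a coset is obtained
    by sorting. *)

(** * Least lifts of colors *)

Section Words.

Variable p : nat.
Notation r := p.+1.
Notation letter := (nat * color r)%type.

Implicit Types (a b m : nat) (z : color r) (x y : letter) (w v : seq letter).

Lemma color_ofD a b : color_of r (a + b) = (color_of r a + color_of r b)%R.
Proof. by apply: val_inj; rewrite /= modnDm. Qed.

Lemma color_of_val z : color_of r z = z.
Proof. exact: valZpK. Qed.

Lemma color_ofDr a : color_of r (a + r) = color_of r a.
Proof. by apply: val_inj; rewrite /= modnDr. Qed.

(** The least natural number of color [z] that is not below [a]. *)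
Definition least_lift a z : nat := a + (z - color_of r a)%R.

Lemma least_lift_ge a z : a <= least_lift a z.
Proof. exact: leq_addr. Qed.

Lemma least_lift_lt a z : least_lift a z < a + r.
Proof. by rewrite ltn_add2l. Qed.

Lemma color_least_lift a z : color_of r (least_lift a z) = z.
Proof. by rewrite color_ofD color_of_val addrC subrK. Qed.

Lemma least_lift_eq a m z : a <= m < a + r -> color_of r m = z -> least_lift a z = m.
Proof.
case/andP=> le_am lt_m <-; rewrite /least_lift.
rewrite -{1}(subnKC le_am) color_ofD addrC addKr /= modn_small ?subnKC //.
lia.
Qed.

(** Raising the bound does nothing until it passes the lift, which then moves to
    the next number of the same color: this is how a letter reacts to an
    insertion on its right. *)
Lemma least_lift_from a m z : a <= m <= least_lift a z + r ->
  least_lift m z = if m <= least_lift a z then least_lift a z else least_lift a z + r.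
Proof.
case/andP=> le_am le_m; have := least_lift_lt a z.
case: (leqP m (least_lift a z)) => m_up lt_up;
  apply: least_lift_eq; rewrite ?color_ofDr ?color_least_lift //; lia.
Qed.

Lemma least_liftDr a z : least_lift (a + r) z = least_lift a z + r.
Proof.
apply: least_lift_eq; last by rewrite color_ofDr color_least_lift.
by have := least_lift_ge a z; have := least_lift_lt a z; lia.
Qed.

(** * The flag-major index of a word *)

(** Colors are ignored on purpose: requiring a strict increase at a descent
    between different colors does not change the least lift. *)
Definition falls x w : bool := if w is y :: _ then y.1 < x.1 else false.

(** The number lambda of the first letter. *)
Fixpoint lam w : nat :=
  if w is x :: w' then least_lift (lam w' + falls x w') x.2 else 0.

Lemma lam_cons x w : lam (x :: w) = least_lift (lam w + falls x w) x.2.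
Proof. by []. Qed.

Fixpoint wmaj w : nat := if w is x :: w' then lam w + wmaj w' else 0.

(** One more than [lam w], except at the end of a word: the bound that [w] sets
    to a letter larger than all of its own. *)
Definition top w : nat := lam w + (w != [::]).

Lemma top_cons x w : top (x :: w) = (lam (x :: w)).+1.
Proof. exact: addn1. Qed.

Lemma falls_top x w : lam w + falls x w <= top w <= (lam w + falls x w).+1.
Proof. by rewrite /top; case: w => //= y w; case: (y.1 < x.1); lia. Qed.

Lemma top_cons_ge x w : top w <= top (x :: w).
Proof.
rewrite top_cons lam_cons.
by have := falls_top x w; have := least_lift_ge (lam w + falls x w) x.2; lia.
Qed.

Lemma top_cons_le x w : top (x :: w) <= top w + r.
Proof.
rewrite top_cons lam_cons.
by have := falls_top x w; have := least_lift_lt (lam w + falls x w) x.2; lia.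
Qed.

Lemma top_le_size w : top w <= r * size w.
Proof.
by elim: w => // x w IH; have := top_cons_le x w; rewrite /= mulnS; lia.
Qed.

(** * Inserting a largest letter *)

Section Insertion.

Variable N : nat.

Definition below w := all (fun x => x.1 < N) w.

Lemma lam_big z w : below w -> lam ((N, z) :: w) = least_lift (top w) z.
Proof. by case: w => //= y w /andP[-> _]. Qed.

Lemma lam_cons_big x z w : x.1 < N -> below w ->
  lam [:: x, (N, z) & w] =
    if lam ((N, z) :: w) < top (x :: w) then lam (x :: w) else lam (x :: w) + r.
Proof.
move=> xN wN.
have xN_rise : falls x ((N, z) :: w) = false by rewrite /= ltnNge ltnW.
rewrite lam_cons xN_rise addn0 lam_big // top_cons ltnS lam_cons.
apply: least_lift_from.
have := least_lift_ge (lam w + falls x w) x.2; have := least_lift_lt (top w) z.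
by have := least_lift_ge (top w) z; have := falls_top x w; lia.
Qed.

Fixpoint insertions w : seq (seq letter) :=
  [seq (N, z) :: w | z <- enum (color r)] ++
  (if w is x :: w' then [seq x :: v | v <- insertions w'] else [::]).

(** The insertions that are not at the front: those that keep the first letter,
    so that the effect on a letter further left depends on [lam] alone. *)
Definition inner_insertions w : seq (seq letter) :=
  if w is x :: w' then [seq x :: v | v <- insertions w'] else [::].

Lemma insertionsE w :
  insertions w =
    [seq (N, z) :: w | z <- enum (color r)] ++ inner_insertions w.
Proof. by case: w. Qed.

Local Open Scope ring_scope.

Lemma sum_insertionsE (H : seq letter -> {poly int}) w :
  \sum_(v <- insertions w) H v =
    \sum_(z : color r) H ((N, z) :: w) + \sum_(v <- inner_insertions w) H v.
Proof. by rewrite insertionsE big_cat big_map big_enum. Qed.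

(** As the color varies, the number of a largest letter in front of [w] takes
    each of the [r] values from [top w] on once. *)
Lemma sum_lam_big (H : nat -> {poly int}) w : below w ->
  \sum_(z : color r) H (lam ((N, z) :: w)) =
    \sum_(top w <= m < top w + r) H m.
Proof.
move=> wN; rewrite -[X in index_iota X _]add0n big_addn addKn big_mkord.
rewrite (reindex_inj (addrI (color_of r (top w)))).
apply: eq_bigr => i _; congr H; rewrite lam_big //; apply: least_lift_eq.
  by rewrite leq_addl addnC ltn_add2l /=.
by rewrite addnC color_ofD color_of_val.
Qed.

(** The function [G] keeps track of the number of the first letter, which an
    inner insertion leaves as it is or raises by [r]: this is all that the
    induction on the word needs to know of the insertion in the tail.  The two
    intervals are the increments of either kind. *)
Lemma sum_inner_insertions (G : nat -> {poly int}) w : below w ->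
  \sum_(v <- inner_insertions w) 'X^(wmaj v) * G (lam v) =
  'X^(wmaj w) * (G (lam w) * \sum_(0 <= m < top w) 'X^m
     + G (lam w + r)%N * \sum_(top w + r <= m < r * (size w).+1) 'X^m).
Proof.
elim: w G => [|x w IH] G wN.
  by rewrite big_nil muln1 !big_geq // !mulr0 addr0 mulr0.
have /= /andP[xN w'N] := wN.
rewrite big_map sum_insertionsE.
set lx := lam (x :: w).
have lxE : lx = least_lift (lam w + falls x w) x.2 by [].
(* The number of [x] once a letter of number [m] has been put after it. *)
pose f m := (if (m < top (x :: w))%N then lx else (lx + r)%N).
have front : \sum_(z : color r)
    'X^(wmaj [:: x, (N, z) & w]) * G (lam [:: x, (N, z) & w]) =
  \sum_(top w <= m < top w + r) 'X^(f m + (m + wmaj w)) * G (f m).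
  rewrite -(sum_lam_big (fun m => 'X^(f m + (m + wmaj w)) * G (f m))) //.
  apply: eq_bigr => z _.
  by rewrite -[wmaj _]/(lam _ + (lam _ + wmaj w))%N lam_cons_big.
(* An inner insertion in [w] keeps the first letter of [w], hence [falls]. *)
have lam_tail v : v \in inner_insertions w ->
    lam (x :: v) = least_lift (lam v + falls x w) x.2.
  by case: (w) => [|y u]; rewrite ?in_nil // => /mapP[v' _ ->].
have tail :
  \sum_(v <- inner_insertions w) 'X^(wmaj (x :: v)) * G (lam (x :: v)) =
  \sum_(v <- inner_insertions w) 'X^(wmaj v) *
     ('X^(least_lift (lam v + falls x w) x.2) *
      G (least_lift (lam v + falls x w) x.2)).
  apply: eq_big_seq => v /lam_tail lamE.
  by rewrite [wmaj _]/(lam (x :: v) + wmaj v)%N lamE exprD; ring.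
rewrite front tail.
(* The [G] of the tail accounts for the contribution of [x]. *)
rewrite (IH (fun l => 'X^(least_lift (l + falls x w) x.2) *
                      G (least_lift (l + falls x w) x.2))) //.
rewrite addnAC least_liftDr -lxE.
have [t_ge t_le] := (top_cons_ge x w, top_cons_le x w).
have t_size := top_le_size w.
rewrite (big_cat_nat t_ge t_le) /=.
(* Among the insertions right after [x], those that [x] tolerates have a number
   below [top (x :: w)]; the others raise [x] by [r]. *)
have below_lx : \sum_(top w <= m < top (x :: w))
      'X^(f m + (m + wmaj w)) * G (f m) =
    'X^(lx + wmaj w) * G lx * \sum_(top w <= m < top (x :: w)) 'X^m.
  rewrite big_distrr; apply: eq_big_nat => m /andP[_ lt_m] /=.
  by rewrite /f lt_m !exprD; ring.
have above_lx : \sum_(top (x :: w) <= m < top w + r)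
      'X^(f m + (m + wmaj w)) * G (f m) =
    'X^(lx + wmaj w) * G (lx + r)%N *
      \sum_(top (x :: w) + r <= m < top w + r + r) 'X^m.
  rewrite [X in _ = _ * X]big_addn addnK big_distrr.
  apply: eq_big_nat => m /andP[le_m _] /=.
  by rewrite /f ltnNge le_m /= !exprD; ring.
rewrite below_lx above_lx.
rewrite (big_cat_nat (leq0n _) t_ge) /=.
have le1 : (top (x :: w) + r <= top w + r + r)%N by rewrite leq_add2r.
have le2 : (top w + r + r <= r * (size w).+2)%N by rewrite !mulnS; lia.
rewrite (big_cat_nat le1 le2) /=.
have -> : \sum_(top w + r + r <= m < r * (size w).+2) 'X^m =
   'X^r * \sum_(top w + r <= m < r * (size w).+1) 'X^m :> {poly int}.
  rewrite (mulnS r (size w).+1) (addnC r (r * _)%N) [LHS]big_addn addnK big_distrr /=.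
  by apply: eq_bigr => m _; rewrite exprD mulrC.
by rewrite !exprD; ring.
Qed.

(** Insertions at the front have increments from [top w] to [top w + r - 1],
    which is the gap left between the two intervals of inner insertions. *)
Lemma sum_insertions w : below w ->
  \sum_(v <- insertions w) 'X^(wmaj v) = 'X^(wmaj w) * qint (r * (size w).+1).
Proof.
move=> wN; rewrite sum_insertionsE.
have -> : \sum_(z : color r) 'X^(wmaj ((N, z) :: w)) =
    'X^(wmaj w) * \sum_(top w <= m < top w + r) 'X^m :> {poly int}.
  rewrite big_distrr /= -(sum_lam_big (fun m => 'X^(wmaj w) * 'X^m)) //.
  by apply: eq_bigr => z _; rewrite -exprD addnC.
have := sum_inner_insertions (fun=> 1) wN.
under eq_bigr do rewrite mulr1.
move=> ->; rewrite /qint -(big_mkord xpredT (fun i => 'X^i)).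
have t_size := top_le_size w.
rewrite (@big_cat_nat _ _ _ (top w) 0 (r * _)) //=; last by rewrite mulnS; lia.
rewrite (@big_cat_nat _ _ _ (top w + r) (top w) (r * _)) ?leq_addr //=.
  by ring.
by rewrite mulnS; lia.
Qed.

Local Close Scope ring_scope.

Lemma mem_insertionsP w v :
  reflect (exists u1 z u2, w = u1 ++ u2 /\ v = u1 ++ (N, z) :: u2)
          (v \in insertions w).
Proof.
apply: (iffP idP) => [|[u1 [z [u2 [-> ->]]]]].
  elim: w v => [|x w IH] v; rewrite insertionsE mem_cat => /orP[/mapP[z _ ->]|].
  - by exists [::], z, [::].
  - by rewrite in_nil.
  - by exists [::], z, (x :: w).
  case/mapP=> _ /IH[u1 [z [u2 [-> ->]]]] ->.
  by exists (x :: u1), z, u2.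
elim: u1 => [|x u1 IH] /=.
  by rewrite insertionsE mem_cat map_f ?mem_enum.
by rewrite mem_cat (map_f (cons x)) ?orbT.
Qed.

Lemma filter_insertions w v :
  below w -> v \in insertions w -> [seq x <- v | x.1 < N] = w.
Proof.
move=> wN /mem_insertionsP[u1 [z [u2 [defw ->]]]].
by rewrite filter_cat /= ltnn -filter_cat -defw; apply/all_filterP.
Qed.

Lemma uniq_insertions w : below w -> uniq (insertions w).
Proof.
elim: w => [|x w IH] wN; rewrite insertionsE cat_uniq map_inj_uniq ?enum_uniq //=;
  try by move=> z1 z2 [].
have /= /andP[xN w'N] := wN.
rewrite map_inj_uniq ?IH // => [|u v []//].
rewrite andbT; apply/hasPn=> _ /mapP[v _ ->]; apply/mapP=> -[z _ [xE _]].
by rewrite xE ltnn in xN.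
Qed.

End Insertion.

(** * Words that contain 1, ..., k in order with color 0 *)

Section Generation.

Variable k : nat.

Definition base : seq letter := [seq (i, 0%R) | i <- iota 0 k].

Fixpoint shuffles d : seq (seq letter) :=
  if d is d'.+1 then [seq v | w <- shuffles d', v <- insertions (k + d') w]
  else [:: base].

Definition is_shuffle n w : bool :=
  [&& perm_eq (map fst w) (iota 0 n),
      all (fun x => (x.1 < k) ==> (x.2 == 0%R)) w
    & pairwise (fun x y => (x.1 < k) && (y.1 < k) ==> (x.1 < y.1)) w].

Lemma is_shuffle_below n w : is_shuffle n w -> below n w.
Proof.
case/and3P=> /perm_mem mem_w _ _; apply/allP=> x x_w.
by have := mem_w x.1; rewrite map_f // mem_iota => /esym/andP[].
Qed.

Lemma is_shuffle_insert n u1 z u2 : k <= n ->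
  is_shuffle n.+1 (u1 ++ (n, z) :: u2) = is_shuffle n (u1 ++ u2).
Proof.
move=> le_kn; rewrite /is_shuffle !map_cat -(addn1 n) iotaD /= cats1 add0n.
rewrite (perm_catCA _ [:: n]) perm_sym perm_rcons perm_sym perm_cons.
have n_big : (n < k) = false by rewrite ltnNge le_kn.
rewrite !all_cat !pairwise_cat allrel_consr /= n_big /=.
rewrite [X in X && allrel _ _ _](_ : _ = true); last first.
  by apply/allP=> y _; rewrite andbF.
by rewrite [X in X && pairwise _ u2](_ : _ = true) //; apply/allP.
Qed.

Lemma is_shuffle_base w : is_shuffle k w = (w == base).
Proof.
apply/idP/eqP=> [w_sh | ->].
  have wk := is_shuffle_below w_sh; case/and3P: w_sh => perm_w col_w inc_w.
  have letE : map fst w = iota 0 k.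
    apply: (irr_sorted_eq ltn_trans ltnn) (iota_ltn_sorted _ _) (perm_mem perm_w).
    rewrite (sorted_pairwise ltn_trans) pairwise_map.
    apply: sub_in_pairwise inc_w; last by apply/allP=> x; exact: (allP wk).
    by move=> x y /= xk yk; rewrite [x.1 < k]xk [y.1 < k]yk.
  rewrite /base -letE -map_comp -[LHS]map_id; apply/eq_in_map => -[i z] x_w /=.
  by have /= := allP col_w _ x_w; rewrite (allP wk _ x_w) => /eqP->.
rewrite /is_shuffle /base -map_comp map_id perm_refl /=.
apply/andP; split; first by apply/allP=> _ /mapP[i _ ->] /=; rewrite eqxx implybT.
rewrite pairwise_map; apply: sub_pairwise (_ : pairwise ltn _).
  by move=> i j /= ->; rewrite implybT.
by rewrite -(sorted_pairwise ltn_trans) iota_ltn_sorted.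
Qed.

Lemma mem_shuffles d w : (w \in shuffles d) = is_shuffle (k + d) w.
Proof.
elim: d w => [|d IH] w; first by rewrite addn0 inE is_shuffle_base.
rewrite addnS; apply/allpairsPdep/idP => [[u [v []]] | w_sh].
  rewrite IH => u_sh /mem_insertionsP[u1 [z [u2 [defu ->]]]] ->.
  by rewrite is_shuffle_insert ?leq_addr // -defu.
have n_w : k + d \in map fst w.
  by case/and3P: w_sh => /perm_mem-> _ _; rewrite mem_iota leqnn.
case/mapP: n_w => -[n z] x_w /= nE; rewrite -{}nE in x_w.
case/splitPr: x_w w_sh => u1 u2; rewrite is_shuffle_insert ?leq_addr // => u_sh.
exists (u1 ++ u2), (u1 ++ (k + d, z) :: u2); split; rewrite ?IH //.
by apply/mem_insertionsP; exists u1, z, u2.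
Qed.

Lemma uniq_shuffles d : uniq (shuffles d).
Proof.
elim: d => //= d IH; apply: allpairs_uniq_dep => //.
  by move=> w; rewrite mem_shuffles => /is_shuffle_below; exact: uniq_insertions.
move=> _ _ /allpairsPdep[w1 [v1 [w1P v1P ->]]] /allpairsPdep[w2 [v2 [w2P v2P ->]]].
move=> /= eq_v; rewrite eq_v in v1P *.
have filterE w : w \in shuffles d -> v2 \in insertions (k + d) w -> _ :=
  fun w_d => @filter_insertions _ w v2
    (is_shuffle_below (etrans (esym (mem_shuffles d w)) w_d)).
by rewrite -(filterE _ w1P v1P) (filterE _ w2P v2P).
Qed.

Lemma wmaj_base : wmaj base = 0.
Proof.
have base0 m a : lam [seq (i, 0%R) | i <- iota a m] = 0 /\
    wmaj [seq (i, 0%R) | i <- iota a m] = 0.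
  elim: m a => // m IH a; have [lam0 wmaj0] := IH a.+1.
  have rise : falls (a, 0%R) [seq (i, 0%R) | i <- iota a.+1 m] = false.
    by case: (m) => //= m'; rewrite ltnNge leqnSn.
  have lam0' : lam [seq (i, 0%R) | i <- iota a m.+1] = 0.
    by rewrite lam_cons lam0 rise (@least_lift_eq _ 0) //; apply: val_inj.
  by rewrite [wmaj _]/(lam _ + wmaj _) lam0' wmaj0.
by have [] := base0 k 0.
Qed.

Lemma sum_shuffles d :
  (\sum_(w <- shuffles d) 'X^(wmaj w) =
     \prod_(k.+1 <= i < (k + d).+1) qint (r * i))%R.
Proof.
elim: d => [|d IH] /=.
  by rewrite addn0 big_geq // big_seq1 wmaj_base.
rewrite big_allpairs_dep /= addnS big_nat_recr ?ltnS ?leq_addr //= -IH.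
rewrite mulr_suml big_seq [RHS]big_seq; apply: eq_bigr => w.
rewrite mem_shuffles => w_sh; rewrite sum_insertions; last exact: is_shuffle_below.
by case/and3P: w_sh => /perm_size; rewrite size_map size_iota => ->.
Qed.

End Generation.

End Words.

(** * Agreement with the homogeneous descents and the color partition *)

Section HomogeneousDescents.

Variable p : nat.
Notation r := p.+1.
Notation letter := (nat * color r)%type.

Implicit Types (z : color r) (x y : letter) (w v : seq letter).

Lemma lift_colors_cons z (s : seq (color r)) :
  lift_colors (z :: s) = least_lift (head 0 (lift_colors s)) z :: lift_colors s.
Proof. by rewrite /= /least_lift /= modnDmr. Qed.

Lemma drop_lift_colors m (s : seq (color r)) :
  drop m (lift_colors s) = lift_colors (drop m s).
Proof. by elim: s m => [|z s IH] [|m] //=; rewrite IH. Qed.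

Definition hdesc x w : bool :=
  if w is y :: _ then (x.2 == y.2) && (y.1 < x.1) else false.

Fixpoint hdescs w : nat :=
  if w is x :: w' then hdesc x w' + hdescs w' else 0.

Lemma least_liftDMl h m z : least_lift (r * h + m) z = r * h + least_lift m z.
Proof.
elim: h => [|h IH]; first by rewrite muln0.
rewrite mulnS; move: (r * h) IH => rh IH.
by rewrite -!addnA ![r + _]addnC least_liftDr IH.
Qed.

(** Both sides grow in the same way along the word: a descent between equal
    colors forces a full turn [r], and one between different colors is met by
    the least lift without any. *)
Lemma lam_hdescs w :
  lam w = r * hdescs w + head 0 (lift_colors (map snd w)).
Proof.
elim: w => [|x w IH]; first by rewrite muln0.
rewrite lam_cons map_cons lift_colors_cons IH -addnA least_liftDMl.
rewrite [hdescs (x :: w)]/(hdesc x w + hdescs w) mulnDr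
  [r * hdesc _ _ + _]addnC -addnA.
congr (_ + _).
rewrite -[head 0 (_ :: _)]/(least_lift (head 0 (lift_colors (map snd w))) x.2).
case: w {IH} => [|y w]; first by rewrite muln0 !addn0.
set l := head 0 _; have l_col : color_of r l = y.2.
  by rewrite /l map_cons lift_colors_cons; exact: color_least_lift.
have -> : hdesc x (y :: w) = (x.2 == y.2) && falls x (y :: w) by [].
case: (falls _ _); last by rewrite andbF muln0 !addn0.
rewrite andbT addn1; have := least_lift_ge l x.2; have := least_lift_lt l x.2.
have [x_l | x_nl] := eqVneq x.2 y.2.
  have up_l : least_lift l x.2 = l by apply: least_lift_eq; rewrite ?l_col ?x_l //; lia.
  rewrite up_l muln1 [RHS]addnC => _ _.
  apply: least_lift_eq; last by rewrite color_ofDr l_col x_l.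
  lia.
rewrite muln0 add0n => lt_up le_up.
have up_nl : least_lift l x.2 != l.
  by apply: contraNneq x_nl => up_l; rewrite -l_col -up_l color_least_lift.
by apply: least_lift_eq; [lia | exact: color_least_lift].
Qed.

Lemma wmajE w : wmaj w = \sum_(i < size w) lam (drop i w).
Proof.
elim: w => [|x w IH]; first by rewrite big_ord0.
by rewrite -[size _]/(size w).+1 big_ord_recl drop0 -[LHS]/(lam _ + wmaj w) IH.
Qed.

End HomogeneousDescents.

(** * Words of elements of the wreath product *)

Section WreathWords.

Variables p n : nat.
Notation r := p.+1.

Implicit Types (g h : {perm cint r n}) (i j : 'I_n) (k : nat).

Definition word g : seq (nat * color r) :=
  [seq (val (sigma g i), zcol g i) | i <- enum 'I_n].

Lemma size_word g : size (word g) = n.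
Proof. by rewrite size_map size_enum_ord. Qed.

Lemma nth_word d g i : nth d (word g) i = (val (sigma g i), zcol g i).
Proof. by rewrite (nth_map i) ?size_enum_ord // nth_ord_enum. Qed.

Lemma kpartE g : kpart g = lift_colors (map snd (word g)) :> seq nat.
Proof.
rewrite -map_comp; set s := map _ _.
have [ls_s srt_s min_s] := lift_colorsP s.
have sz_s : size (lift_colors s) == n.
  by rewrite -(size_map (color_of r)) ls_s size_map size_enum_ord.
have colE (l : n.-tuple nat) : map (color_of r) l = s <->
    forall i, g (Defs.col0 r i) = (sigma g i, color_of r (tnth l i)).
  split=> [ls i | lP].
    rewrite [LHS]surjective_pairing -/(sigma g i) -/(zcol g i); congr (_, _).
    have /(congr1 (fun t => nth (zcol g i) t i)) := ls.
    rewrite (nth_map i) ?size_enum_ord // nth_ord_enum => /= <-.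
    by rewrite (nth_map 0) ?size_tuple // (tnth_nth 0).
  rewrite -(map_tnth_enum l) -map_comp; apply: eq_map => i /=.
  by rewrite /zcol lP.
have lP : least_color_partition g (Tuple sz_s).
  split=> [|l' [srt' /colE ls'] i]; first by split=> //; apply/colE.
  by rewrite !(tnth_nth 0); apply: min_s.
by rewrite (least_color_partition_unique (kpartP g) lP).
Qed.

Lemma mem_HDes g i :
  (i \in HDes g) = hdesc (nth (0, 0%R) (word g) i) (drop i.+1 (word g)).
Proof.
rewrite inE nth_word; case: (ltnP i.+1 n) => [lt_in | le_ni]; last first.
  rewrite drop_oversize ?size_word //; apply/existsP=> -[j /and3P[/eqP jE _ _]].
  by move: (ltn_ord j); rewrite jE ltnNge le_ni.
rewrite (drop_nth (0, 0%R)) ?size_word //.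
rewrite -[i.+1]/(val (Ordinal lt_in)) nth_word /=.
apply/existsP/idP=> [[j /and3P[/eqP jE zE lt_s]] | hd].
  by rewrite (_ : Ordinal _ = j) ?zE //; apply: val_inj.
by exists (Ordinal lt_in); rewrite eqxx.
Qed.

Lemma card_HDes g m :
  #|[set j : 'I_n in HDes g | m <= j]| = hdescs (drop m (word g)).
Proof.
have [d le_d] := ubnP (n - m); elim: d m le_d => // d IH m le_d.
have [le_nm | lt_mn] := leqP n m.
  rewrite drop_oversize ?size_word //; apply: eq_card0 => j.
  by rewrite !inE leqNgt (leq_trans (ltn_ord j) le_nm) andbF.
pose i := Ordinal lt_mn; rewrite (drop_nth (0, 0%R)) ?size_word // -[m]/(val i).
rewrite [RHS]/(hdesc _ _ + hdescs _) -mem_HDes -IH; last by rewrite /=; lia.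
rewrite (cardsD1 i); congr (_ + _); first by rewrite in_set leqnn andbT.
apply: eq_card => j; rewrite in_setD1 !(in_set (fun=> _ && _)) ltn_neqAle.
by rewrite andbCA eq_sym.
Qed.

Lemma flambdaE g i : flambda g i = lam (drop i (word g)).
Proof.
rewrite /flambda /hdes card_HDes lam_hdescs; congr (_ + _).
by rewrite (tnth_nth 0) kpartE map_drop -drop_lift_colors -nth0 nth_drop addn0.
Qed.

Lemma fmajE g : fmaj g = wmaj (word g).
Proof.
by rewrite wmajE size_word; apply: eq_bigr => i _; rewrite flambdaE.
Qed.

Lemma word_inj : {in wreath r n &, injective word}.
Proof.
move=> g h /wreathP gP /wreathP hP eq_gh; apply/permP=> -[i z].
have := congr1 (fun w => nth (0, 0%R) w i) eq_gh.
by rewrite !nth_word gP hP => -[/val_inj-> ->].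
Qed.

Lemma sigma_inj g : g \in wreath r n -> injective (sigma g).
Proof.
move=> /wreathP gP i j eq_s.
have : g (i, (- zcol g i)%R) = g (j, (- zcol g j)%R).
  by rewrite !gP !subrr eq_s.
by move/perm_inj=> [].
Qed.

Lemma word_letters g : g \in wreath r n -> perm_eq (map fst (word g)) (iota 0 n).
Proof.
move=> gW; rewrite -map_comp -val_enum_ord (map_comp val (sigma g)).
apply: perm_map; apply: uniq_perm; rewrite ?enum_uniq //.
  by rewrite map_inj_uniq ?enum_uniq //; apply: sigma_inj.
move=> i; rewrite mem_enum; apply/mapP.
have [s' sK s'K] := injF_bij (sigma_inj gW).
by exists (s' i); rewrite ?mem_enum.
Qed.

Lemma word_surj (w : seq (nat * color r)) :
  perm_eq (map fst w) (iota 0 n) -> exists2 g, g \in wreath r n & word g = w.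
Proof.
move=> perm_w; pose d := (0, 0%R) : nat * color r.
have sz_w : size w = n by have /perm_size := perm_w; rewrite size_map size_iota.
pose s i : 'I_n := insubd i (nth d w i).1.
have sE i : s i = (nth d w i).1 :> nat.
  rewrite val_insubd (_ : (_ < n) = true) //.
  have := perm_mem perm_w (nth d w i).1; rewrite mem_iota /= => <-.
  by rewrite map_f ?mem_nth ?sz_w.
have s_inj : injective s.
  move=> i j /(congr1 val) /=; rewrite !sE -!(nth_map _ 0) ?sz_w // => /eqP.
  by rewrite nth_uniq ?size_map ?sz_w ?(perm_uniq perm_w) ?iota_uniq // => /eqP/val_inj.
pose f (x : cint r n) : cint r n := (s x.1, ((nth d w x.1).2 + x.2)%R).
have f_inj : injective f.
  move=> [i a] [j b] eq_f; have /= ij := s_inj _ _ (congr1 fst eq_f).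
  by have /= := congr1 snd eq_f; rewrite ij => /addrI->.
have sg i : sigma (perm f_inj) i = s i by rewrite /sigma permE.
have zg i : zcol (perm f_inj) i = (nth d w i).2 by rewrite /zcol permE /= addr0.
exists (perm f_inj); first by apply/wreathP=> i z; rewrite permE sg zg.
apply: (@eq_from_nth _ d); rewrite size_word ?sz_w // => m lt_m.
by rewrite -[m]/(val (Ordinal lt_m)) nth_word sg zg [val (s _)]sE -surjective_pairing.
Qed.

Lemma pairwise_enum_ord (R : rel 'I_n) :
  reflect (forall i j, i < j -> R i j) (pairwise R (enum 'I_n)).
Proof.
apply: (iffP idP) => [pwR i j lt_ij | RP].
  move/(pairwiseP i)/(_ i j): pwR; rewrite !inE size_enum_ord !nth_ord_enum.
  by apply.
apply: sub_pairwise (_ : pairwise (relpre val ltn) _) => //.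
by rewrite -pairwise_map val_enum_ord -(sorted_pairwise ltn_trans) iota_ltn_sorted.
Qed.

(** * Words of coset representatives and of their inverses *)

Lemma coset_repsP k g :
  reflect [/\ g \in wreath r n, forall i, i < k -> zcol g i = 0%R
            & forall i j, i < j < k -> sigma g i < sigma g j]
          (g \in coset_reps r n k).
Proof.
rewrite [_ \in coset_reps _ _ _]in_set.
apply: (iffP and3P) => -[gW /= gz gs]; split=> //.
- by move=> i lt_i; apply/eqP; move/forallP/(_ i)/implyP: gz; apply.
- by move=> i j lt_ij; move/forallP/(_ i)/forallP/(_ j)/implyP: gs; apply.
- by apply/forallP=> i; apply/implyP=> lt_i; rewrite gz.
- by apply/forallP=> i; apply/forallP=> j; apply/implyP; apply: gs.
Qed.

Lemma wreathV_col0 h i : h \in wreath r n ->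
  h^-1%g (Defs.col0 r (sigma h i)) = (i, (- zcol h i)%R).
Proof.
move/wreathP=> hP; apply: (@perm_inj _ h).
by rewrite permKV hP subrr.
Qed.

(** Inversion exchanges positions and values: the condition on the first [k]
    positions of the inverse becomes one on the letters below [k]. *)
Lemma coset_repsV k h : h \in wreath r n ->
  (h^-1%g \in coset_reps r n k) = is_shuffle k n (word h).
Proof.
move=> hW; rewrite /is_shuffle word_letters //=.
have sV i : sigma h^-1 (sigma h i) = i by rewrite /sigma wreathV_col0.
have zV i : zcol h^-1 (sigma h i) = (- zcol h i)%R by rewrite /zcol wreathV_col0.
have [s' sK s'K] := injF_bij (sigma_inj hW).
rewrite pairwise_map.
apply/coset_repsP/andP=> [[_ hz hs] | [hz /pairwise_enum_ord /= hs]]; split.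
- apply/allP=> _ /mapP[i _ ->] /=; apply/implyP=> lt_i.
  by rewrite -[zcol h i]opprK -zV hz ?oppr0.
- apply/pairwise_enum_ord=> i j lt_ij /=; apply/implyP=> /andP[lt_i lt_j].
  rewrite ltnNge leq_eqVlt; apply/norP; split.
    by apply: contraL lt_ij => /eqP/val_inj/(sigma_inj hW)->; rewrite ltnn.
  apply/negP=> lt_s; have := hs (sigma h j) (sigma h i).
  by rewrite lt_s lt_i !sV => /(_ isT); rewrite ltnNge ltnW.
- by rewrite (groupV (wreath_group r n)).
- move=> i lt_i; rewrite -(s'K i) zV; have := allP hz (nth (0, 0%R) (word h) (s' i)).
  rewrite mem_nth ?size_word // nth_word /= s'K lt_i => /(_ isT) /eqP->.
  by rewrite oppr0.
move=> i j /andP[lt_ij lt_j]; rewrite -(s'K i) -(s'K j) !sV.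
have := hs (s' j) (s' i); rewrite !s'K lt_j (ltn_trans lt_ij lt_j) /=.
case: ltngtP => // [_ /(_ isT) | /val_inj eq_s _]; first by rewrite ltnNge ltnW.
by move: lt_ij; rewrite -(s'K i) -(s'K j) eq_s ltnn.
Qed.

Lemma perm_shuffles k : k <= n ->
  perm_eq [seq word g^-1%g | g <- enum (coset_reps r n k)] (shuffles p k (n - k)).
Proof.
move=> le_kn; apply: uniq_perm; rewrite ?uniq_shuffles //.
  rewrite map_inj_in_uniq ?enum_uniq // => g h.
  rewrite !mem_enum => /coset_repsP[gW _ _] /coset_repsP[hW _ _].
  by move/word_inj; rewrite !(groupV (wreath_group r n)) => /(_ gW hW) /invg_inj.
move=> w; rewrite mem_shuffles subnKC //; apply/mapP/idP => [[g] | w_sh].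
  rewrite mem_enum => g_rep ->; have /coset_repsP[gW _ _] := g_rep.
  by rewrite -coset_repsV ?invgK // (groupV (wreath_group r n)).
have /and3P[/word_surj[h hW hw] _ _] := w_sh.
by exists h^-1%g; rewrite ?invgK // mem_enum coset_repsV // hw.
Qed.

Lemma sum_coset_reps k : k <= n ->
  (\sum_(g in coset_reps r n k) 'X^(fmaj (g^-1)%g) =
    \prod_(k.+1 <= i < n.+1) qint (r * i))%R.
Proof.
move=> le_kn; have := sum_shuffles p k (n - k); rewrite subnKC // => <-.
rewrite -(perm_big _ (perm_shuffles le_kn)).
by rewrite big_map big_enum /=; apply: eq_bigr => g _; rewrite fmajE.
Qed.

(** * The representative of a coset *)

Lemma mem_rcoset_sub k g x : g \in wreath r n ->
  (x \in wreath_sub r n k :* g)%g =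
    (x \in wreath r n) &&
      [forall i : 'I_n, (k <= i) ==> (x (Defs.col0 r i) == g (Defs.col0 r i))].
Proof.
move=> gW; rewrite mem_rcoset [_ \in wreath_sub _ _ _]in_set.
rewrite (groupMr (G := wreath_group r n)) ?(groupV (wreath_group r n)) //.
congr (_ && _); apply: eq_forallb => i; congr (_ ==> _).
by rewrite permM; apply/eqP/eqP=> [/(canRL (permKV g)) | ->] //; rewrite permK.
Qed.

Lemma drop_word k g (x : {perm cint r n}) :
  (forall i, k <= i -> x (Defs.col0 r i) = g (Defs.col0 r i)) ->
  drop k (word x) = drop k (word g).
Proof.
move=> eq_xg; apply: (@eq_from_nth _ (0, 0%R));
  rewrite !size_drop !size_word // => m lt_m.
rewrite !nth_drop; have lt_km : k + m < n by lia.
by rewrite -[k + m]/(val (Ordinal lt_km)) !nth_word /sigma /zcol eq_xg //= leq_addr.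
Qed.

Definition coset_rep_word k g : seq (nat * color r) :=
  [seq (m, 0%R) | m <- sort leq (take k (map fst (word g)))] ++ drop k (word g).

Lemma coset_rep_word_letters k g : g \in wreath r n ->
  perm_eq (map fst (coset_rep_word k g)) (iota 0 n).
Proof.
move=> gW; rewrite /coset_rep_word map_cat -map_comp map_id.
rewrite (permPl (perm_cat (permEl (perm_sort leq _)) (perm_refl _))).
by rewrite map_drop cat_take_drop word_letters.
Qed.

(** Past position [k] the words of a coset agree, so that their first [k] letters
    are the same up to order, and there is only one way to sort them. *)
Lemma word_of_coset_rep k g x : g \in wreath r n ->
  x \in coset_reps r n k -> x \in (wreath_sub r n k :* g)%g ->
  word x = coset_rep_word k g.
Proof.
move=> gW /coset_repsP[xW xz xs]; rewrite mem_rcoset_sub // => /andP[_ /forallP xg].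
have eq_drop : drop k (word x) = drop k (word g).
  by apply: drop_word => i le_ki; apply/eqP; move/implyP: (xg i); apply.
rewrite -(cat_take_drop k (word x)) /coset_rep_word -eq_drop; congr (_ ++ _).
have lt_nth m : m < size (take k (word x)) -> m < k /\ m < n.
  by rewrite size_take_min size_word; lia.
have eq_take : take k (word x) = [seq (m, 0%R) | m <- map fst (take k (word x))].
  rewrite -map_comp map_id_in // => y /(nthP (0, 0%R))[m /lt_nth[lt_mk lt_mn] <-].
  by rewrite nth_take // -[m]/(val (Ordinal lt_mn)) nth_word /= xz.
rewrite [LHS]eq_take; congr map.
apply: (sorted_eq leq_trans anti_leq); rewrite ?sort_sorted //; last 2 first.
- exact: leq_total.
(* Cancel the common end of the two words, both rearrangements of 0, ..., n-1. *)
- rewrite perm_sym perm_sort perm_sym -map_take.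
  rewrite -(perm_cat2r (map fst (drop k (word x)))) {2}eq_drop -!map_cat !cat_take_drop.
  by rewrite (permPl (word_letters xW)) perm_sym word_letters.
apply: (sub_sorted ltnW); rewrite sorted_pairwise ?pairwise_map; last exact: ltn_trans.
apply/(pairwiseP (0, 0%R))=> a b /lt_nth[lt_ak lt_an] /lt_nth[lt_bk lt_bn] lt_ab.
rewrite !nth_take // -[a]/(val (Ordinal lt_an)) -[b]/(val (Ordinal lt_bn)).
by rewrite !nth_word /= xs //= lt_ab.
Qed.

Lemma card_coset_reps k g : k <= n -> g \in wreath r n ->
  #|coset_reps r n k :&: (wreath_sub r n k :* g)%g| = 1.
Proof.
move=> le_kn gW.
have [x xW xE] := word_surj (coset_rep_word_letters k gW).
apply/eqP/cards1P; exists x; apply/setP=> y; rewrite in_setI in_set1.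
apply/andP/eqP=> [[y_rep y_g] | ->{y}].
  apply: word_inj => //; first by case/coset_repsP: y_rep.
  by rewrite xE; apply: word_of_coset_rep.
pose s := sort leq (take k (map fst (word g))).
have sz_s : size s = k by rewrite size_sort size_takel // size_map size_word.
have s_lt : sorted ltn s.
  rewrite ltn_sorted_uniq_leq sort_uniq.
  rewrite take_uniq ?(perm_uniq (word_letters gW)) ?iota_uniq //.
  exact/sort_sorted/leq_total.
have x_small i : i < k -> (val (sigma x i), zcol x i) = (nth 0 s i, 0%R).
  move=> lt_ik; rewrite -(nth_word (0, 0%R)) xE nth_cat size_map sz_s lt_ik.
  by rewrite (nth_map 0) ?sz_s.
split.
  apply/coset_repsP; split=> // [i /x_small[] // | i j /andP[lt_ij lt_jk]].
  have [[-> _] [-> _]] := (x_small i (ltn_trans lt_ij lt_jk), x_small j lt_jk).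
  by rewrite (sorted_ltn_nth ltn_trans) ?inE ?sz_s // (ltn_trans lt_ij).
rewrite mem_rcoset_sub // xW; apply/forallP=> i; apply/implyP=> le_ki.
have := nth_word (0, 0%R) x i.
rewrite xE nth_cat size_map sz_s ltnNge le_ki nth_drop subnKC // nth_word.
case=> /val_inj s_eq z_eq; apply/eqP.
by rewrite [LHS]surjective_pairing [RHS]surjective_pairing; congr (_, _).
Qed.

End WreathWords.

Theorem corollary5p6 (r n k : nat) (r_gt0 : 0 < r) (n_gt0 : 0 < n)
    (k_ltn : k < n) :
  (forall g : {perm cint r n}, g \in wreath r n ->
     #|coset_reps r n k :&: (wreath_sub r n k :* g)%g| = 1) /\
  (\sum_(g in coset_reps r n k) 'X^(fmaj (g^-1)%g))%R =
    (\prod_(k.+1 <= i < n.+1) qint (r * i)%N)%R.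
Proof.
case: r r_gt0 => // p _; split; last exact/sum_coset_reps/ltnW.
by move=> g; apply/card_coset_reps/ltnW.
Qed.
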